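(* There exists a randomized algorithm in the adversarial comparator model (against an adaptive adversary) that, on input $n$ items, makes $O(n\log^2 n)$ comparisons, uses $O(\log n)$ parallel rounds, and returns a $4$-approximate sorting of the items with probability $>1-\frac{1}{n^2}$.
   Context: Adversarial comparator model: we are given $n$ items $x_1,\dots,x_n$ with unknown real values. The algorithm can only access the items through a comparator $C$ which, given two items $x_i,x_j$, returns $\max\{x_i,x_j\}$ if $|x_i-x_j|>1$, and otherwise returns either $x_i$ or $x_j$ as chosen by an adversary. The adversary is adaptive: its choices may depend on all previous queries and answers. In the parallel (round) model, in each round the algorithm submits a set of comparisons, chosen based on the answers of previous rounds, and receives all their answers. For reals $a,b$ write $a\ge_k b$ if $a\ge b-k$. An ordering $y_1,\dots,y_n$ of the items is a $k$-approximate sorting if $y_j\ge_k y_i$ for all $j>i$. *)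

(* Defs.v *)
From HB Require Import structures.
From mathcomp Require Import all_boot all_order all_algebra all_fingroup.
From mathcomp Require Import all_classical all_reals all_analysis.
Set Implicit Arguments.
Unset Strict Implicit.
Unset Printing Implicit Defensive.
Import Order.TTheory GRing.Theory Num.Theory.
Local Open Scope ring_scope.

(* Everything revealed in one round: [None] exactly at the pairs that were not
   queried, and [Some w] at a queried pair whose comparison returned item [w].
   It therefore records the queries of the round as well as their answers. *)
Definition answers (n : nat) := {ffun 'I_n * 'I_n -> option 'I_n}.

(* Deterministic round-based algorithms on n items, as decision trees.  The
   tree never mentions the values: it branches on comparator answers only.
   [Output s] is the ordering y_1, ..., y_n in which y_i is item [s i]. *)
Inductive strategy (n : nat) : Type :=
| Output of 'S_n
| Round of {set 'I_n * 'I_n} & (answers n -> strategy n).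

(* [adv h Q (i, j)] is the item the adversary favours ([true] for i, [false]
   for j) when the earlier rounds were [h] and the current round queries [Q].
   It may answer a repeated query differently. *)
Definition adversary (n : nat) :=
  seq (answers n) -> {set 'I_n * 'I_n} -> 'I_n * 'I_n -> bool.

Definition comparator (R : realType) (n : nat) (x : 'I_n -> R)
    (b : bool) (i j : 'I_n) : 'I_n :=
  if 1 < `|x i - x j| then (if x j < x i then i else j)
  else (if b then i else j).

Definition reply (R : realType) (n : nat) (x : 'I_n -> R) (adv : adversary n)
    (h : seq (answers n)) (Q : {set 'I_n * 'I_n}) : answers n :=
  [ffun p => if p \in Q then Some (comparator x (adv h Q p) p.1 p.2) else None].

(* The complete transcript, in chronological order, and the final ordering,
   when [h] is the transcript of the rounds already played. *)
Fixpoint run_from (R : realType) (n : nat) (x : 'I_n -> R) (adv : adversary n)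
    (h : seq (answers n)) (S : strategy n) : seq (answers n) * 'S_n :=
  match S with
  | Output s => (h, s)
  | Round Q next =>
      let a := reply x adv h Q in run_from x adv (rcons h a) (next a)
  end.

Definition run (R : realType) (n : nat) (x : 'I_n -> R) (adv : adversary n)
    (S : strategy n) : seq (answers n) * 'S_n := run_from x adv [::] S.

Definition output (R : realType) (n : nat) (x : 'I_n -> R) (adv : adversary n)
    (S : strategy n) : 'S_n := (run x adv S).2.

Definition num_rounds (R : realType) (n : nat) (x : 'I_n -> R)
    (adv : adversary n) (S : strategy n) : nat := size (run x adv S).1.

Definition num_comparisons (R : realType) (n : nat) (x : 'I_n -> R)
    (adv : adversary n) (S : strategy n) : nat :=
  (\sum_(a <- (run x adv S).1) #|[set p | isSome (a p)]|)%N.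

(* A randomized algorithm draws its private coins [w] from a finite probability
   space and then plays [strat w].  Adversaries take no coins as argument: they
   learn about [w] only through the queries. *)
Record rand_alg (R : realType) (n : nat) := RandAlg {
  coins : finType;
  weight : coins -> R;
  weight_ge0 : forall w, 0 <= weight w;
  weight_sum1 : \sum_(w : coins) weight w = 1;
  strat : coins -> strategy n
}.

Definition Pr (R : realType) (n : nat) (A : rand_alg R n)
    (E : pred (coins A)) : R := \sum_(w : coins A | E w) weight w.

Definition ge_approx (R : realType) (k a b : R) : bool := b - k <= a.

Definition approx_sorting (R : realType) (n : nat) (k : R) (x : 'I_n -> R)
    (s : 'S_n) : bool :=
  [forall i : 'I_n, forall j : 'I_n,
    (i < j)%N ==> ge_approx k (x (s j)) (x (s i))].

(* Main.v *)
Require Import Defs.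
From mathcomp Require Import all_boot all_order all_algebra all_fingroup.
From mathcomp Require Import all_classical all_reals all_analysis.
From mathcomp Require Import ring lra zify.
Set Implicit Arguments.
Unset Strict Implicit.
Unset Printing Implicit Defensive.
Import Order.TTheory GRing.Theory Num.Theory.
Local Open Scope ring_scope.

(** The algorithm is a quicksort whose blocks are all split in parallel, one
round per level.  A block of size N is indexed by Z/N, and d = O(log n) fresh
uniform shifts s_k are drawn; every item y is compared with the d pivots s_k and
with the d items y + s_k.  The block is ranked by the number of pivots beaten,
ties being broken by the number of wins in the shift comparisons.

If x_u > x_v + 2 then u beats every pivot that v beats, so cutting between two
different pivot counts is always 2-correct.  If no such cut is balanced, most of
the block has one and the same pivot count t, and it is cut inside that group.
An inversion x_u > x_v + 4 within the group forces almost no item to lie in the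
interval ]x_v + 1, x_u - 1[, and t/d to approximate the proportion lam of the set
L = {x <= x_v + 1}.  When t >= d/2, L is large; u beats all of its neighbours in
L, that is about 2 d lam of them, whereas the items of L beat on average only
about d lam neighbours, since each comparison inside L has a single winner.
Hence many items rank below u, so u cannot be among the lowest N/32 items, which
are the ones cut off.  The case t < d/2 is symmetric and cuts off the top N/32.
Every cut is balanced, so the cost bounds hold surely; only the concentration of
the shifts can fail, and a union bound over blocks and levels controls it. *)

(** * Inversions inside a group of equal pivot counts *)

Section Wins.
Variables (V : finZmodType) (d : nat) (s : 'I_d -> V) (win : rel V).

Definition pivot_wins (y : V) : nat := (\sum_(k < d) win y (s k))%N.

(* Both endpoints are credited: [y] plays [y + s k] and is played by [y - s k].
   Counting only the first kind would let the adversary make every item win. *)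
Definition shift_wins (y : V) : nat :=
  (\sum_(k < d) (win y (y + s k)%R + ~~ win (y - s k)%R y))%N.

End Wins.

Definition hits (V : finZmodType) (d : nat) (s : 'I_d -> V) (T : pred V) (y : V) : nat :=
  (\sum_(k < d) T (y + s k)%R)%N.

(** Quantifying over all translates [y] lets one condition serve both the pivots ([y = 0]) and the
    shift neighbours of every item. *)
Definition equidistributed (R : realType) (V : finZmodType) (d : nat)
    (s : 'I_d -> V) (T : pred V) : Prop :=
  forall y, `|(hits s T y)%:R - d%:R * (#|T|%:R / #|V|%:R)| <= d%:R / 64 :> R.

(** A termwise inequality between sums with equal totals is an equality in every term. *)
Lemma pivot_wins_eq (V : finZmodType) (d : nat) (s : 'I_d -> V) (win : rel V) u v :
  (forall k, win v (s k) -> win u (s k)) ->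
  pivot_wins s win u = pivot_wins s win v ->
  forall k, win u (s k) = win v (s k).
Proof.
move=> vu /esym/eqP E k.
have := @leqif_sum _ predT (fun k => win v (s k) == win u (s k))
  (fun k => win v (s k) : nat) (fun k => win u (s k) : nat).
case=> [i _|_].
  by split; [case: (win v _) (vu i) => // -> | case: (win v _); case: (win u _)].
by rewrite E => /esym/forallP/(_ k)/eqP.
Qed.

Section NoInversion.
Variables (R : realType) (V : finZmodType) (d : nat) (s : 'I_d -> V) (win : rel V).
Variables (x : V -> R) (u v : V).
Hypothesis win_le : forall i j, win i j -> x j <= x i + 1.
Hypothesis lose_le : forall i j, ~~ win i j -> x i <= x j + 1.
Hypothesis far : x v + 4 < x u.

Let L : pred V := [pred z | x z <= x v + 1].
Let T : pred V := [pred z | x z < x u - 1].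
Let M : pred V := [pred z | T z && ~~ L z].

Lemma subLT z : L z -> T z.
Proof. rewrite /L /T /= => h; move: far; lra. Qed.

Lemma card_band : (#|L| + #|M| = #|T|)%N.
Proof.
rewrite -(cardID L T); congr addn; apply: eq_card => z; last first.
  by rewrite !inE andbC.
have := @subLT z; rewrite !inE /= => h.
by apply/idP/idP => [Lz|/andP[]//]; rewrite Lz; apply/andP; split => //; exact: h.
Qed.

(** For fixed k, reindexing by [w + s k] makes both kinds of credit refer to the pair [w],
    [w + s k], whose single winner gets one point. A winner in [L] has its opponent in [L] or [M]:
    the first case is a hit of [L], the second is charged to [M], once per endpoint. *)
Lemma shift_wins_low :
  (\sum_(w | L w) shift_wins s win w <= \sum_(w | L w) hits s L w + 2 * d * #|M|)%N.
Proof.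
rewrite /shift_wins /hits [leqLHS]exchange_big [X in (_ <= X + _)%N]exchange_big /=.
have -> : (2 * d * #|M| = \sum_(k < d) (#|M| + #|M|))%N.
  by rewrite sum_nat_const card_ord; lia.
rewrite -big_split /=.
apply: leq_sum => k _; rewrite big_split /=.
rewrite [X in (_ + X <= _)%N](reindex_inj (addIr (s k))) /=.
under [X in (_ + X <= _)%N]eq_bigr do rewrite addrK.
rewrite -sum1_card.
rewrite [X in (_ + (_ + X))%N](reindex_inj (addIr (s k))) /=.
rewrite [X in (X + _ <= _)%N]big_mkcond [X in (_ + X <= _)%N]big_mkcond.
rewrite [X in (_ <= X + _)%N]big_mkcond [X in (_ <= _ + (X + _))%N]big_mkcond.
rewrite [X in (_ <= _ + (_ + X))%N]big_mkcond -!big_split /=.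
apply: leq_sum => w _.
have low z z' : L z -> x z' <= x z + 1 -> L z' || M z'.
  by rewrite /M /L /T /=; case: (x z' <= x v + 1) => //= h1 h2; move: far; lra.
rewrite !inE -!/(L _) -!/(M _).
have := @low w (w + s k); have := @low (w + s k) w.
have := @win_le w (w + s k); have := @lose_le w (w + s k).
case: (win _ _) => /= h1 h2 h3 h4.
  have {}h4 := h4^~ (h2 isT); move: h4; rewrite /M.
  by case: (L w) => //= [/(_ isT)|]; case: (L (w + s k)) => //= ->; lia.
have {}h3 := h3^~ (h1 isT); move: h3; rewrite /M.
by case: (L (w + s k)) => //= [/(_ isT)|]; case: (L w) => //= ->; lia.
Qed.

Lemma no_inversion : (0 < d)%N ->
  equidistributed R s L -> equidistributed R (fun k => - s k) L ->
  equidistributed R s T ->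
  pivot_wins s win u = pivot_wins s win v -> (d <= 2 * pivot_wins s win v)%N ->
  (16 * #|[pred w | shift_wins s win w < shift_wins s win u]| <= #|V|)%N -> False.
Proof.
move=> d0 gL gL' gT eqf tf few.
have vu k : win v (s k) -> win u (s k).
  move=> /win_le h; apply/negPn/negP => /lose_le; move: far h; lra.
have eqw := pivot_wins_eq vu eqf.
(* A pivot below [x u - 1] is beaten by [u], hence by [v], hence lies in [L]: no pivot falls into
   the band [M]. *)
have TL k : T (s k) -> L (s k).
  rewrite /T /= => h; apply: win_le; rewrite -eqw; apply/negPn/negP => /lose_le; lra.
have hTL : (hits s T 0%R <= hits s L 0%R)%N.
  by apply: leq_sum => k _; rewrite add0r; case: (T _) (@TL k) => // ->.
have hv : (pivot_wins s win v <= hits s L 0%R)%N.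
  apply: leq_sum => k _; rewrite add0r; case E: (win _ _) => //.
  by rewrite /L /= (win_le E).
have gu : (hits s L u + hits (fun k => - s k)%R L u <= shift_wins s win u)%N.
  rewrite -big_split; apply: leq_sum => k _; apply: leq_add.
    case E: (win _ _); first exact: leq_b1.
    move/negbT/lose_le: E; case E': (L _) => //.
    by move: E' far; rewrite /L /=; lra.
  case E: (win _ _); last exact: leq_b1.
  move/win_le: E; case E': (L _) => //.
  by move: E' far; rewrite /L /=; lra.
have := shift_wins_low.
have : (\sum_(w | L w) hits s L w)%:R <=
    #|L|%:R * (d%:R * (#|L|%:R / #|V|%:R) + d%:R / 64) :> R.
  rewrite natr_sum mulr_natl -sumr_const; apply: ler_sum => w _.
  by have := gL w; rewrite ler_norml; lra.
(* Items of [L] scoring at least as much as [u] pay for themselves; the others are among the few. *)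
have : (#|L| * shift_wins s win u <= \sum_(w | L w) shift_wins s win w +
   #|[pred w | shift_wins s win w < shift_wins s win u]| * shift_wins s win u)%N.
  rewrite -!sum_nat_const big_mkcond [X in (_ <= X + _)%N]big_mkcond.
  rewrite [X in (_ <= _ + X)%N]big_mkcond -big_split /=; apply: leq_sum => w _.
  by rewrite /L !inE /=; case: ifP => //= _; case: ltnP => //=; lia.
move: (gL 0) (gT 0) (gL u) (gL' u).
rewrite !ler_norml => /andP[_ gL1] /andP[gT1 _] /andP[gLu _] /andP[gLu' _].
have N0 : (0 < #|V|)%N by apply/card_gt0P; exists 0.
move: card_band few.
set l := #|L|; set m := #|M|; set t := #|T|; set N := #|V|; set few := #|_|.
set S1 := (\sum_(_ | _) shift_wins _ _ _)%N; set S2 := (\sum_(_ | _) hits _ _ _)%N.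
move: hTL hv gu tf gL1 gT1 gLu gLu'; rewrite -/l -/m -/t -/N.
set hL := hits s L 0; set hT := hits s T 0; set a1 := hits s L u.
set a2 := hits _ L u; set G := shift_wins s win u; set p := pivot_wins _ _ v.
rewrite -!(ler_nat R) !(natrD, natrM).
have Nr : 0 < N%:R :> R by rewrite ltr0n.
have dr : 0 < d%:R :> R by rewrite ltr0n.
move=> hTL hv gu tf gL1 gT1 gLu gLu' /(congr1 (fun z => z%:R : R)) lmt fewN.
move: lmt; rewrite /= natrD => lmt h1 h2 h3.
set lam : R := l%:R / N%:R in gL1 gLu gLu' h2.
have lE : l%:R = lam * N%:R by rewrite divfK // gt_eqF.
set tau : R := t%:R / N%:R in gT1.
have tE : t%:R = tau * N%:R by rewrite divfK // gt_eqF.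
(* At least d/2 pivots are beaten by [v], all of them in [L]; 31/64 is 1/2 minus the tolerance
   1/64. *)
have lam_ge : 31/64 <= lam.
  have : d%:R * (31/64) <= d%:R * lam by lra.
  by rewrite ler_pM2l.
have lam_le : lam <= 1.
  by rewrite ler_pdivrMr // mul1r ler_nat max_card.
(* Pivots hit [T] no more often than [L], so the two proportions differ by at most two tolerances;
   this makes [M] small. *)
have tau_le : tau <= lam + 1/32.
  have : d%:R * tau <= d%:R * (lam + 1/32) by lra.
  by rewrite ler_pM2l.
have m_le : m%:R <= N%:R / 32 :> R.
  have : tau * N%:R <= (lam + 1/32) * N%:R by rewrite ler_pM2r.
  lra.
have G_ge : 2 * d%:R * (lam - 1/64) <= G%:R by lra.
have : (lam * N%:R - N%:R / 16) * G%:R <=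
       lam * N%:R * (d%:R * lam + d%:R / 64) + 2 * d%:R * (N%:R / 32).
  have : (lam * N%:R - N%:R / 16) * G%:R <= S1%:R.
    have : few%:R * G%:R <= N%:R / 16 * G%:R :> R.
      by apply: ler_wpM2r; move: fewN; lra.
    by move: h1; rewrite lE; lra.
  have : 2 * d%:R * m%:R <= 2 * d%:R * (N%:R / 32) :> R.
    by apply: ler_wpM2l; lra.
  by move: h2 h3; rewrite lE; lra.
have : (lam * N%:R - N%:R / 16) * (2 * d%:R * (lam - 1/64)) <=
   (lam * N%:R - N%:R / 16) * G%:R.
  apply: ler_wpM2l => //.
  have : (lam - 1/16) * N%:R >= 0 by apply: mulr_ge0; lra.
  lra.
move=> /le_trans h /h {h}.
have -> : (lam * N%:R - N%:R / 16) * (2 * d%:R * (lam - 1 / 64)) =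
  (d%:R * N%:R) * ((lam - 1/16) * (2 * (lam - 1/64))) by field.
have -> : lam * N%:R * (d%:R * lam + d%:R / 64) + 2 * d%:R * (N%:R / 32) =
  (d%:R * N%:R) * (lam * (lam + 1/64) + 1/16) by field.
(* What remains, 2 (lam - 1/16) (lam - 1/64) <= lam (lam + 1/64) + 1/16, fails for every lam >=
   31/64. *)
rewrite ler_pM2l ?mulr_gt0 //; nra.
Qed.

End NoInversion.

(** * Ranking and cutting a block *)

Lemma eq_equidistributed (R : realType) (V : finZmodType) (d : nat)
    (s : 'I_d -> V) (T T' : pred V) :
  T =1 T' -> equidistributed R s T -> equidistributed R s T'.
Proof.
move=> eqT h y; have := h y; rewrite (eq_card eqT).
by rewrite /hits; under eq_bigr do rewrite eqT.
Qed.

Lemma equidistributedC (R : realType) (V : finZmodType) (d : nat)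
    (s : 'I_d -> V) (T : pred V) :
  equidistributed R s T -> equidistributed R s (predC T).
Proof.
move=> h y; have := h y.
have N0 : #|V|%:R != 0 :> R by rewrite pnatr_eq0 -lt0n; apply/card_gt0P; exists 0.
have hN : #|T|%:R + #|predC T|%:R = #|V|%:R :> R by rewrite -natrD cardC.
have hd : (hits s T y)%:R + (hits s (predC T) y)%:R = d%:R :> R.
  rewrite -natrD -big_split /= (eq_bigr (fun=> 1%N)) ?sum1_card ?card_ord //.
  by move=> k _; case: (T _).
have -> : #|predC T|%:R = #|V|%:R - #|T|%:R :> R by rewrite -hN; ring.
rewrite mulrBl divff // -normrN -hd.
by congr (_ <= _); congr `|_|; ring.
Qed.

(** These are the sets [L] and [T] of [no_inversion] for every threshold. Under [x := - x] the two
    families are exchanged up to complement, so having both signs of shift for both makes the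
    condition symmetric. *)
Definition well_spread (R : realType) (V : finZmodType) (d : nat)
    (s : 'I_d -> V) (x : V -> R) : Prop := forall j,
  [/\ equidistributed R s [pred z | x z <= x j + 1],
      equidistributed R (fun k => - s k) [pred z | x z <= x j + 1],
      equidistributed R s [pred z | x z < x j - 1] &
      equidistributed R (fun k => - s k) [pred z | x z < x j - 1]].

Lemma well_spreadN (R : realType) (V : finZmodType) (d : nat)
    (s : 'I_d -> V) (x : V -> R) :
  well_spread s x -> well_spread s (fun z => - x z).
Proof.
move=> h j; have [h1 h2 h3 h4] := h j.
have e1 : predC [pred z | x z < x j - 1] =1 [pred z | - x z <= - x j + 1].
  by move=> z /=; rewrite -leNgt; apply/idP/idP; lra.
have e2 : predC [pred z | x z <= x j + 1] =1 [pred z | - x z < - x j - 1].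
  by move=> z /=; rewrite -ltNge; apply/idP/idP; lra.
by split; [apply: eq_equidistributed e1 _ | apply: eq_equidistributed e1 _
  | apply: eq_equidistributed e2 _ | apply: eq_equidistributed e2 _];
  apply: equidistributedC.
Qed.

(** Used on a ranking: the window from [a] to [b] is a stretch of constant pivot count, where the
    scores are monotone. *)
Lemma count_outside (T : Type) (x0 : T) (P : pred T) (S : seq T) (a b : nat) :
  (a <= b)%N -> (forall i, (a <= i < b)%N -> ~~ P (nth x0 S i)) ->
  (count P S <= a + (size S - b))%N.
Proof.
move=> ab h; rewrite -{1}(cat_take_drop a S) -{1}(cat_take_drop (b - a) (drop a S)).
rewrite drop_drop subnK // !count_cat.
have -> : count P (take (b - a) (drop a S)) = 0%N.
  apply/eqP; rewrite -leqn0 leqNgt -has_count; apply/(has_nthP x0) => -[i].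
  rewrite size_take => hi; rewrite nth_take ?nth_drop; last by case: ifP hi; lia.
  by apply/negP/h; case: ifP hi; lia.
rewrite add0n; apply: leq_add; apply: leq_trans (count_size _ _) _.
  by rewrite size_take; case: ltnP; lia.
by rewrite size_drop.
Qed.

Section Split.
Variables (V : finZmodType) (d : nat) (s : 'I_d -> V) (win : rel V).
Local Notation f := (pivot_wins s win).
Local Notation g := (shift_wins s win).

Definition wins_le (y z : V) : bool := (f y < f z)%N || (f y == f z) && (g y <= g z)%N.

Definition ranking : seq V := sort wins_le (enum V).

(** [lo] is the last of the bottom q items and [hi] the first of the top q. If their pivot counts
    agree, everything between shares that count and the cut is made inside the group; otherwise it
    is made where the count first exceeds that of [lo]. *)
Definition cut : nat :=
  let q := (#|V| %/ 32).+1 in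
  let lo := nth 0 ranking q.-1 in
  let hi := nth 0 ranking (#|V| - q) in
  if f lo == f hi then (if (d <= 2 * f lo)%N then q else (#|V| - q)%N)
  else find (fun y => f lo < f y)%N ranking.

Lemma wins_le_total : total wins_le.
Proof. by move=> y z; rewrite /wins_le; case: ltngtP => //= _; apply: leq_total. Qed.

Lemma wins_le_trans : transitive wins_le.
Proof. by move=> z y w; rewrite /wins_le; lia. Qed.

Lemma size_ranking : size ranking = #|V|.
Proof. by rewrite size_sort cardE. Qed.

Lemma nth_ranking_le i j : (i <= j < #|V|)%N ->
  wins_le (nth 0 ranking i) (nth 0 ranking j).
Proof.
case/andP=> ij jN; apply: (sorted_leq_nth wins_le_trans) => //.
- by move=> y; rewrite /wins_le eqxx leqnn orbT.
- exact: (sort_sorted wins_le_total).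
- by rewrite inE size_ranking; lia.
- by rewrite inE size_ranking.
Qed.

Lemma nth_ranking_pivot_le i j : (i <= j < #|V|)%N ->
  (f (nth 0%R ranking i) <= f (nth 0%R ranking j))%N.
Proof. by move/nth_ranking_le; rewrite /wins_le; lia. Qed.

(** When the cut is found by search, [lo] fails the test and [hi] passes it; since pivot counts
    increase along the ranking, the first success lies between them. *)
Lemma cutP : (1 < #|V|)%N ->
  ((#|V| %/ 32).+1 <= cut <= #|V| - (#|V| %/ 32).+1)%N.
Proof.
set q := (_ %/ _).+1 => N1; have qN : (2 * q <= #|V|)%N by rewrite /q; lia.
rewrite /cut -/q; case: eqP => [_|neq]; first by case: ifP; lia.
have lohi : (f (nth 0%R ranking q.-1) < f (nth 0%R ranking (#|V| - q)))%N.
  by rewrite ltn_neqAle (introN eqP neq) nth_ranking_pivot_le //; lia.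
have le : (find (fun y => f (nth 0%R ranking q.-1) < f y)%N ranking <= #|V| - q)%N.
  by rewrite leqNgt; apply/negP => /(before_find 0%R); rewrite lohi.
rewrite le andbT leqNgt; apply/negP => lt.
have := @nth_find _ 0 (fun y => f (nth 0%R ranking q.-1) < f y)%N ranking.
rewrite has_find size_ranking; set F := find _ _ in le lt *.
have -> : (F < #|V|)%N by lia.
by move=> /(_ isT); rewrite ltnNge nth_ranking_pivot_le //; lia.
Qed.

Lemma split_size : (1 < #|V|)%N ->
  (32 * size (take cut ranking) <= 31 * #|V|)%N /\
  (32 * size (drop cut ranking) <= 31 * #|V|)%N.
Proof.
by move=> /cutP h; rewrite size_drop size_take size_ranking; case: ltnP; lia.
Qed.

End Split.

Section NoInversionWellSpread.
Variables (R : realType) (V : finZmodType) (d : nat) (s : 'I_d -> V) (win : rel V).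
Variable x : V -> R.
Hypothesis win_le : forall i j, win i j -> x j <= x i + 1.
Hypothesis lose_le : forall i j, ~~ win i j -> x i <= x j + 1.
Hypothesis d_gt0 : (0 < d)%N.
Hypothesis spread : well_spread s x.
Local Notation f := (pivot_wins s win).
Local Notation g := (shift_wins s win).

Lemma no_inversion_low u v : x v + 4 < x u -> f u = f v -> (d <= 2 * f v)%N ->
  (16 * #|[pred w | g w < g u]| <= #|V|)%N -> False.
Proof.
move=> far; have [h1 h2 _ _] := spread v; have [_ _ h3 _] := spread u.
exact: (no_inversion win_le lose_le far d_gt0 h1 h2 h3).
Qed.

End NoInversionWellSpread.

Section SplitCorrect.
Variables (R : realType) (V : finZmodType) (d : nat) (s : 'I_d -> V) (win : rel V).
Variable x : V -> R.
Hypothesis win_le : forall i j, win i j -> x j <= x i + 1.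
Hypothesis lose_le : forall i j, ~~ win i j -> x i <= x j + 1.
Hypothesis d_gt0 : (0 < d)%N.
Hypothesis spread : well_spread s x.
Local Notation f := (pivot_wins s win).
Local Notation g := (shift_wins s win).
Local Notation S := (ranking s win).

(* The mirror image of [no_inversion_low] under [x := - x], [win := ~~ win]. *)
Lemma no_inversion_high u v : x v + 4 < x u -> f u = f v -> (2 * f v <= d)%N ->
  (16 * #|[pred w | g v < g w]| <= #|V|)%N -> False.
Proof.
move=> far eqf hf few.
pose win' : rel V := fun i j => ~~ win i j.
have fC y : (f y + pivot_wins s win' y = d)%N.
  rewrite -big_split /= (eq_bigr (fun=> 1%N)) ?sum1_card ?card_ord //.
  by move=> k _; rewrite /win'; case: (win _ _).
have gC y : (g y + shift_wins s win' y = 2 * d)%N.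
  rewrite -big_split /= (eq_bigr (fun=> 2%N)) ?sum_nat_const ?card_ord 1?mulnC //.
  by move=> k _; rewrite /win'; case: (win _ _); case: (win _ _).
apply: (@no_inversion_low _ _ _ _ win' (fun z => - x z) _ _ d_gt0 _ v u).
- by move=> i j /lose_le; lra.
- by move=> i j; rewrite negbK => /win_le; lra.
- exact: well_spreadN.
- by move: far; lra.
- by have := fC u; have := fC v; lia.
- by have := fC u; lia.
- apply: leq_trans few; rewrite leq_mul2l /=; apply: subset_leq_card.
  apply/fintype.subsetP => w; rewrite !inE; have := gC w; have := gC v; lia.
Qed.

Lemma split_correct u v : (1 < #|V|)%N ->
  u \in take (cut s win) S -> v \in drop (cut s win) S -> x u <= x v + 4.
Proof.
move=> N1 uT vD; rewrite leNgt; apply/negP => far.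
have cP := cutP s win N1; set q := (#|V| %/ 32).+1 in cP.
have [i iq uE] : exists2 i, (i < cut s win)%N & u = nth 0 S i.
  case/(nthP 0): uT => i; rewrite size_take size_ranking => hi <-.
  by exists i; [case: ifP hi; lia | rewrite nth_take //; case: ifP hi; lia].
have [j /andP[jq jN] vE] : exists2 j, (cut s win <= j < #|V|)%N & v = nth 0 S j.
  case/(nthP 0): vD => j; rewrite size_drop size_ranking => hj <-.
  by exists (cut s win + j)%N; [lia | rewrite nth_drop].
have uv : wins_le s win u v by rewrite uE vE nth_ranking_le //; lia.
(* The gap exceeds 2, so [u] beats every pivot that [v] beats; the ranking gives the opposite
   inequality. *)
have fvu : (f v <= f u)%N.
  apply: leq_sum => k _; case E: (win v _) => //.
  suff -> : win u (s k) by [].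
  by move/win_le: E => E; apply/negPn/negP => /lose_le; move: far E; lra.
have eqf : f u = f v by move: uv; rewrite /wins_le; lia.
have pcount (P : pred V) : #|P| = count P S.
  rewrite (seq.permP (permEl (perm_sort _ _))) enumT cardE /enum_mem size_filter.
  exact: eq_count.
move: cP jq iq; rewrite /cut -/q.
set lo := nth 0 S q.-1; set hi := nth 0 S (#|V| - q).
have q0 : (32 * q.-1 <= #|V|)%N by rewrite /q; lia.
case: eqP => [lohi|_] cP jq iq; last first.
  (* A cut between distinct pivot counts would give [f u < f v]. *)
  have h1 : (f u <= f lo)%N by rewrite leqNgt uE (before_find 0 iq).
  suff : (f lo < f v)%N by lia.
  set a := (fun y => _) in jq cP.
  have hs : has a S by rewrite has_find size_ranking; lia.
  apply: leq_trans (nth_find 0 hs) _.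
  by rewrite vE nth_ranking_pivot_le // jN andbT.
have mid k : (q.-1 <= k <= #|V| - q)%N -> f (nth 0%R S k) = f lo.
  move=> hk; have := @nth_ranking_pivot_le _ _ s win q.-1 k.
  have := @nth_ranking_pivot_le _ _ s win k (#|V| - q)%N.
  rewrite -/lo -/hi -lohi; lia.
case: ifP cP jq iq => [df|/negbT df] cP jq iq.
  have fu : f u = f lo.
    have : (f u <= f lo)%N by rewrite uE nth_ranking_pivot_le //; lia.
    suff : (f lo <= f v)%N by lia.
    by rewrite vE nth_ranking_pivot_le //; lia.
  apply: (no_inversion_low win_le lose_le d_gt0 spread far eqf); first lia.
  rewrite pcount.
  (* From position i to N - q all items share the pivot count of [u] and score at least as much.
     Those below [u] are thus at most i + (q - 1) <= 2 (q - 1) <= N/16. *)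
  have := @count_outside _ 0 [pred w | g w < g u]%N S i (#|V| - q).+1.
  rewrite size_ranking => h.
  suff : (count [pred w | g w < g u]%N S <= i + (#|V| - (#|V| - q).+1))%N by lia.
  apply: h => [|k hk]; first lia.
  rewrite inE -leqNgt; have := @nth_ranking_le _ _ s win i k.
  have := @nth_ranking_pivot_le _ _ s win k (#|V| - q)%N.
  rewrite -uE /wins_le -/hi -lohi; lia.
have fv : f v = f lo.
  have : (f u <= f hi)%N by rewrite uE nth_ranking_pivot_le //; lia.
  suff : (f hi <= f v)%N by lia.
  by rewrite vE nth_ranking_pivot_le //; lia.
apply: (no_inversion_high far eqf); first lia.
rewrite pcount.
(* Symmetric window: from position q - 1 to j no item scores more than [v]. *)
have := @count_outside _ 0 [pred w | g v < g w]%N S q.-1 j.+1.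
rewrite size_ranking => h.
suff : (count [pred w | g v < g w]%N S <= q.-1 + (#|V| - j.+1))%N by lia.
apply: h => [|k hk]; first lia.
rewrite inE -leqNgt; have := @nth_ranking_le _ _ s win k j.
have := @nth_ranking_pivot_le _ _ s win q.-1 k.
rewrite -vE /wins_le -/lo; lia.
Qed.

End SplitCorrect.

(** * Concentration of random shifts *)

Lemma card_pair (A B : finType) (P : pred (A * B)) :
  #|P| = (\sum_(a : A) #|[pred b | P (a, b)]|)%N.
Proof.
rewrite -sum1_card; under [RHS]eq_bigr do rewrite -sum1_card.
by rewrite pair_big_dep; apply: eq_bigl => -[a b].
Qed.

Lemma card_union_bound (R : realType) (A J : finType) (E : J -> pred A) (b : R) :
  (forall j, #|E j|%:R <= b) -> #|[pred a | [exists j, E j a]]|%:R <= #|J|%:R * b.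
Proof.
move=> h; apply: (@le_trans _ _ (\sum_j #|E j|%:R)); last first.
  by rewrite mulr_natl -sumr_const; apply: ler_sum.
rewrite -natr_sum ler_nat.
under eq_bigr do rewrite -sum1_card.
rewrite -sum1_card (exchange_big_dep xpredT) //= [leqLHS]big_mkcond.
apply: leq_sum => a _; rewrite !inE; case: existsP => [[j Ej]|//].
by rewrite (bigD1 j).
Qed.

(** From exp(-s) >= 1 - s one gets (1 - s) exp(s) <= 1, while (1 - s) (1 + s + 2 s^2) = 1 + s^2 (1 -
    2 s) >= 1. *)
Lemma expR_le_quad (R : realType) (s : R) : 0 <= s <= 1/2 -> expR s <= 1 + s + 2 * s ^+ 2.
Proof.
move=> /andP[s0 s1]; have e0 := expR_gt0 s.
have : 1 - s <= (expR s)^-1 by rewrite -expRN; apply: expR_ge1Dx.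
rewrite -(ler_pM2r e0) mulVf ?gt_eqF // => h.
have : (1 - s) * expR s <= (1 - s) * (1 + s + 2 * s ^+ 2).
  apply: le_trans h _; rewrite expr2.
  have : 0 <= s * s * (1 - 2 * s) by rewrite !mulr_ge0 //; lra.
  lra.
by rewrite ler_pM2l //; lra.
Qed.

(** Markov's inequality for the exponential moment, in counting form: the sum over all functions
    factors over the coordinates. *)
Lemma chernoff (R : realType) (A : finType) (d : nat) (B : pred A) (e : R) :
  (0 < #|A|)%N -> 0 <= e <= 1 ->
  #|[pred c : {ffun 'I_d -> A} |
      d%:R * (#|B|%:R / #|A|%:R + e) < (\sum_(k < d) B (c k))%:R]|%:R
  <= #|{ffun 'I_d -> A}|%:R * expR (- (d%:R * e ^+ 2 / 8)).
Proof.
move=> A0 /andP[e0 e1]; set p : R := _ / _.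
have Ar : 0 < #|A|%:R :> R by rewrite ltr0n.
have p01 : 0 <= p <= 1.
  by rewrite divr_ge0 //= ler_pdivrMr // mul1r ler_nat max_card.
(* This minimises the exponent 2 s^2 - s e obtained from p <= 1; the minimum is - e^2 / 8. *)
pose s := e / 4.
have s0 : 0 <= s <= 1/2 by rewrite /s; lra.
have mgf : \sum_(c : {ffun 'I_d -> A}) expR (s * (\sum_(k < d) B (c k))%:R) =
    (\sum_(a : A) expR (s * (B a)%:R)) ^+ d.
  rewrite -[in RHS](card_ord d) -prodr_const bigA_distr_bigA.
  apply: eq_bigr => c _.
  by rewrite natr_sum mulr_sumr expR_sum.
have mom : \sum_(a : A) expR (s * (B a)%:R) <= #|A|%:R * expR (p * (s + 2 * s ^+ 2)).
  have -> : \sum_(a : A) expR (s * (B a)%:R) = #|A|%:R * (1 + p * (expR s - 1)).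
    rewrite (eq_bigr (fun a => 1 + (B a)%:R * (expR s - 1))); last first.
      by move=> a _; case: (B a) => /=; rewrite ?mulr1 ?mulr0 ?expR0; ring.
    rewrite big_split /= sumr_const -mulr_suml -natr_sum.
    have -> : (\sum_a B a = #|B|)%N by rewrite -sum1_card [RHS]big_mkcond.
    by rewrite /p; field; rewrite gt_eqF.
  rewrite ler_pM2l //; apply: le_trans (expR_ge1Dx _).
  rewrite lerD2l; apply: ler_wpM2l; first by case/andP: p01.
  by have := expR_le_quad s0; lra.
have Em (E : pred {ffun 'I_d -> A}) (b : R) :
    (forall c, E c -> b <= expR (s * (\sum_(k < d) B (c k))%:R)) ->
    #|E|%:R * b <= \sum_(c : {ffun 'I_d -> A}) expR (s * (\sum_(k < d) B (c k))%:R).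
  move=> h; rewrite mulr_natl -sumr_const [leRHS](bigID E) /=.
  by rewrite -[leLHS]addr0; apply: lerD; [exact: ler_sum | exact: sumr_ge0].
set E := [pred c | _].
have : #|E|%:R * expR (s * (d%:R * (p + e))) <=
    (#|A|%:R * expR (p * (s + 2 * s ^+ 2))) ^+ d.
  apply: (@le_trans _ _ ((\sum_(a : A) expR (s * (B a)%:R)) ^+ d)).
    rewrite -mgf; apply: Em => c; rewrite inE => h.
    by rewrite ler_expR; apply: ler_wpM2l; [case/andP: s0 | exact: ltW].
  by apply: lerXn2r mom; rewrite nnegrE ?mulr_ge0 ?expR_ge0 // sumr_ge0.
rewrite exprMn -natrX -expRM_natl -ler_pdivlMr ?expR_gt0 // -expRN => /le_trans; apply.
rewrite -[leLHS]mulrA -expRD card_ffun card_ord.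
apply: ler_wpM2l => //; rewrite ler_expR.
have -> : d%:R * (p * (s + 2 * s ^+ 2)) - s * (d%:R * (p + e)) =
   d%:R * (2 * p * s ^+ 2 - s * e) by ring.
have -> : - (d%:R * e ^+ 2 / 8) = d%:R * (- e ^+ 2 / 8) by ring.
apply: ler_wpM2l => //.
have -> : - e ^+ 2 / 8 = 2 * 1 * s ^+ 2 - s * e by rewrite /s; field.
rewrite lerD2r; apply: ler_wpM2r; first exact: sqr_ge0.
by lra.

Qed.

Lemma sum_modn (F : nat -> nat) (N q : nat) :
  (\sum_(0 <= a < q * N.+1) F (a %% N.+1) = q * \sum_(0 <= a < N.+1) F a)%N.
Proof.
elim: q => [|q IH]; first by rewrite !mul0n big_geq.
rewrite mulSn (@big_cat_nat _ _ _ N.+1) ?leq_addr //= mulSn; congr addn.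
  by apply: eq_big_nat => a /andP[_ h]; rewrite modn_small.
rewrite -{1}[N.+1]add0n big_addn addKn -IH; apply: eq_bigr => a _.
by rewrite modnDr.
Qed.

Lemma card_inZp (N m : nat) (Q : pred 'I_N.+1) : (N.+1 %| m)%N ->
  (#|[pred a : 'I_m | Q (inZp a)]| * N.+1 = #|Q| * m)%N.
Proof.
case/dvdnP => q ->; rewrite mulnA; congr muln.
have -> : (#|Q| = \sum_(0 <= a < N.+1) Q (inZp a))%N.
  rewrite -sum1_card [LHS]big_mkcond big_mkord; apply: eq_bigr => i _.
  by rewrite valZpK.
rewrite [RHS]mulnC -(sum_modn (fun a => Q (inZp a))) -sum1_card [LHS]big_mkcond big_mkord; apply: eq_bigr => i _.
have -> : inZp (i %% N.+1) = inZp i :> 'I_N.+1 by apply: val_inj; rewrite /= modn_mod.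
by rewrite !inE.
Qed.

(* With [m = n`!], [c k] modulo any block size [N.+1 <= n] is uniform. *)
Definition shifts (m N d : nat) (c : {ffun 'I_d -> 'I_m}) : 'I_d -> 'I_N.+1 :=
  fun k => inZp (c k).

Section Shifts.
Variables (R : realType) (m N d : nat).
Hypotheses (m_gt0 : (0 < m)%N) (dvdNm : (N.+1 %| m)%N).
Local Notation Omega := {ffun 'I_d -> 'I_m}.
Local Notation eta := (expR (- (d%:R * (1 / 64) ^+ 2 / 8)) : R).

Lemma hits_tail (Q : pred 'I_N.+1) :
  #|[pred c : Omega | d%:R * (#|Q|%:R / N.+1%:R + 1 / 64) <
      (\sum_(k < d) Q (shifts N c k))%:R :> R]|%:R <= #|Omega|%:R * eta.
Proof.
have := @chernoff R 'I_m d [pred a : 'I_m | Q (inZp a)] (1/64).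
rewrite card_ord m_gt0 => /(_ isT ltac:(lra)).
suff -> : #|Q|%:R / N.+1%:R =
   #|[pred a : 'I_m | Q (inZp a)]|%:R / m%:R :> R by [].
apply/eqP; rewrite eqr_div ?pnatr_eq0 -?lt0n //.
by rewrite -!natrM card_inZp.
Qed.

(** The lower tail of [Q] is the upper tail of its complement. *)
Lemma hits_deviation (Q : pred 'I_N.+1) :
  #|[pred c : Omega | d%:R / 64 <
      `|(\sum_(k < d) Q (shifts N c k))%:R - d%:R * (#|Q|%:R / N.+1%:R)| :> R]|%:R
  <= 2 * (#|Omega|%:R * eta).
Proof.
have h1 := hits_tail Q; have h2 := hits_tail (predC Q).
rewrite [leRHS](_ : _ = #|Omega|%:R * eta + #|Omega|%:R * eta); last by ring.
apply: le_trans (lerD h1 h2).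
rewrite -natrD ler_nat -cardUI; apply: leq_trans (leq_addr _ _).
apply: subset_leq_card; apply/fintype.subsetP => c; rewrite !inE.
have hN : #|Q|%:R + #|predC Q|%:R = N.+1%:R :> R by rewrite -natrD cardC card_ord.
have hd : (\sum_(k < d) Q (shifts N c k))%:R +
   (\sum_(k < d) predC Q (shifts N c k))%:R = d%:R :> R.
  rewrite -natrD -big_split /= (eq_bigr (fun=> 1%N)) ?sum1_card ?card_ord //.
  by move=> k _; case: (Q _).
have -> : #|predC Q|%:R / N.+1%:R = 1 - #|Q|%:R / N.+1%:R :> R.
  have -> : #|predC Q|%:R = N.+1%:R - #|Q|%:R :> R by rewrite -hN; ring.
  by rewrite mulrBl divff ?pnatr_eq0.
move: hd; move: (_ / N.+1%:R : R) (_%:R : R) (\sum_(k < d) predC _ _)%:R => r S1 S2 hd.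
by rewrite lter_normr => /orP[] h; apply/orP; [left | right]; move: h hd; lra.
Qed.

(** Union bound over the base point [y]. The set of [z] with [y + sg z] in [T] has the size of [T],
    because [sg] is a bijection; it will be the identity or the negation. *)
Lemma card_unequidistributed (sg : 'I_N.+1 -> 'I_N.+1) (T : pred 'I_N.+1) :
  injective sg ->
  #|[pred c : Omega | ~~ `[< equidistributed R (fun k => sg (shifts N c k)) T >]]|%:R
  <= N.+1%:R * (2 * (#|Omega|%:R * eta)).
Proof.
move=> sg_inj.
pose E (y : 'I_N.+1) := [pred c : Omega | d%:R / 64 <
      `|(\sum_(k < d) [pred z | T (y + sg z)%R] (shifts N c k))%:R
        - d%:R * (#|[pred z | T (y + sg z)%R]|%:R / N.+1%:R)| :> R].
have := @card_union_bound R _ _ E _ (fun y => hits_deviation _).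
rewrite card_ord; apply: le_trans; rewrite ler_nat.
apply: subset_leq_card; apply/fintype.subsetP => c; rewrite !inE.
apply: contraNT; rewrite negb_exists => /forallP h; apply/asboolP => y.
have := h y; rewrite /= -leNgt card_ord.
suff -> : #|[pred z | T (y + sg z)%R]| = #|T| by [].
rewrite -sum1_card -[RHS]sum1_card; symmetry.
by rewrite (reindex_inj (inj_comp (addrI y) sg_inj)).
Qed.

(** The factor 8 counts two tails, two signs and two families of sets; the square counts base points
    and thresholds. *)
Lemma card_not_well_spread (x : 'I_N.+1 -> R) :
  #|[pred c : Omega | ~~ `[< well_spread (shifts N c) x >]]|%:R
  <= 8 * N.+1%:R ^+ 2 * (#|Omega|%:R * eta).
Proof.
pose sg (b : bool) (z : 'I_N.+1) := if b then z else - z.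
have sgI b : injective (sg b) by case: b => //; apply: oppr_inj.
pose T (j : 'I_N.+1) (b : bool) : pred 'I_N.+1 :=
  if b then [pred z | x z <= x j + 1] else [pred z | x z < x j - 1].
pose E (t : 'I_N.+1 * (bool * bool)) := [pred c : Omega |
  ~~ `[< equidistributed R (fun k => sg t.2.1 (shifts N c k)) (T t.1 t.2.2) >]].
have := @card_union_bound R _ _ E _
  (fun t => card_unequidistributed (T t.1 t.2.2) (sgI t.2.1)).
rewrite !card_prod card_ord card_bool => h; apply: le_trans (le_trans h _); last first.
  by rewrite le_eqVlt; apply/orP; left; apply/eqP; rewrite !natrM; ring.
rewrite ler_nat; apply: subset_leq_card; apply/fintype.subsetP => c; rewrite !inE.
apply: contraNT; rewrite negb_exists => /forallP {}h; apply/asboolP => j.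
have {}h b b' : equidistributed R (fun k => sg b (shifts N c k)) (T j b').
  by have := h (j, (b, b')); rewrite /= negbK => /asboolP.
by split; [apply: (h true true) | apply: (h false true)
  | apply: (h true false) | apply: (h false false)].
Qed.

End Shifts.

(** * The algorithm and its analysis *)

Section Algorithm.
Variables (n d : nat).
Local Notation coin := {ffun 'I_d -> 'I_(n`!)}.

(** Splitting off the head [y] makes the index type an ordinal of successor size, hence the group
    Z/N. *)
Definition item (y : 'I_n) (X : seq 'I_n) (i : 'I_(size X).+1) : 'I_n :=
  nth y (y :: X) i.

Definition block_queries (c : coin) (X : seq 'I_n) : {set 'I_n * 'I_n} :=
  if X is y :: X' then
    let s := shifts (size X') c in
    [set (item y t.1, item y (s t.2)) | t : 'I_(size X').+1 * 'I_d] :|: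
    [set (item y t.1, item y (t.1 + s t.2)%R) | t : 'I_(size X').+1 * 'I_d]
  else finset.set0.

Definition queries (c : coin) (st : seq (seq 'I_n)) : {set 'I_n * 'I_n} :=
  \bigcup_(X <- st) block_queries c X.

Definition answer_win (a : answers n) (y : 'I_n) (X : seq 'I_n) : rel 'I_(size X).+1 :=
  fun i j => a (item y i, item y j) == Some (item y i).

Definition refine_block (c : coin) (a : answers n) (X : seq 'I_n) : seq (seq 'I_n) :=
  if X is y :: X' then
    if (0 < size X')%N then
      let s := shifts (size X') c in
      let win := @answer_win a y X' in
      [:: map (@item y X') (take (cut s win) (ranking s win));
          map (@item y X') (drop (cut s win) (ranking s win))]
    else [:: X]
  else [:: X].

Definition refine (c : coin) (a : answers n) (st : seq (seq 'I_n)) :=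
  flatten (map (refine_block c a) st).

(** The default permutation only makes this total; [arrangementE] excludes it when the blocks
    partition the items. *)
Definition arrangement (st : seq (seq 'I_n)) : 'S_n :=
  odflt 1%g [pick p : 'S_n | [forall i, p i == nth i (flatten st) i]].

(** Each level needs fresh shifts, since its blocks depend on answers to earlier ones. Blocks of one
    level can share a coin, as only a union bound is taken over them. *)
Fixpoint level_coins (D : nat) : finType :=
  if D is D'.+1 then (coin * level_coins D')%type else unit.

Fixpoint sorter (D : nat) : level_coins D -> seq (seq 'I_n) -> strategy n :=
  match D with
  | 0 => fun _ st => Output (arrangement st)
  | D'.+1 => fun w st =>
      Round (queries w.1 st) (fun a => sorter w.2 (refine w.1 a st))
  end.

Lemma map_item_ranking (y : 'I_n) (X : seq 'I_n) s win :
  perm_eq (map (@item y X) (@ranking 'I_(size X).+1 d s win)) (y :: X).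
Proof.
apply: (@perm_trans _ (map (@item y X) (enum 'I_(size X).+1))).
  by apply: perm_map; rewrite perm_sort.
suff -> : map (@item y X) (enum 'I_(size X).+1) = y :: X by [].
apply: (@eq_from_nth _ y); first by rewrite size_map size_enum_ord.
move=> i; rewrite size_map size_enum_ord => hi.
by rewrite (nth_map ord0) ?size_enum_ord // /item nth_enum_ord.
Qed.

Lemma perm_refine_block c a X : perm_eq (flatten (refine_block c a X)) X.
Proof.
case: X => [|y X] //=; case: ifP => _ /=; last by rewrite cats0.
by rewrite cats0 -map_cat cat_take_drop map_item_ranking.
Qed.

Lemma perm_refine c a st : perm_eq (flatten (refine c a st)) (flatten st).
Proof.
elim: st => //= X st IH; rewrite /refine /= flatten_cat.
by apply: perm_cat IH; apply: perm_refine_block.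
Qed.

Lemma card_block_queries c X : (#|block_queries c X| <= 2 * d * size X)%N.
Proof.
case: X => [|y X] /=; first by rewrite cards0.
apply: leq_trans (leq_card_setU _ _) _.
apply: leq_trans (leq_add (leq_imset_card _ _) (leq_imset_card _ _)) _.
by rewrite card_prod !card_ord; lia.
Qed.

Lemma card_queries c st : (#|queries c st| <= 2 * d * size (flatten st))%N.
Proof.
rewrite /queries; elim: st => [|X st IH]; first by rewrite big_nil cards0.
rewrite big_cons /= size_cat mulnDr; apply: leq_trans (leq_card_setU _ _) _.
by apply: leq_add IH; apply: card_block_queries.
Qed.

(** With [D] levels left, block sizes stay below (32/31)^D, so that all blocks have at most one item
    at the end. *)
Lemma size_refine c a st D :
  (forall X, X \in st -> size X * 31 ^ D.+1 <= 32 ^ D.+1)%N ->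
  forall X, X \in refine c a st -> (size X * 31 ^ D <= 32 ^ D)%N.
Proof.
move=> h X /flattenP[B /mapP[Y Yst ->] XB]; have {h Yst} := h _ Yst.
have step (m k : nat) : (32 * m <= 31 * k)%N ->
    (k * 31 ^ D.+1 <= 32 ^ D.+1)%N -> (m * 31 ^ D <= 32 ^ D)%N.
  move=> mk; rewrite !expnS => hk.
  rewrite -(leq_pmul2l (_ : 0 < 32)%N) // mulnA.
  apply: leq_trans _ hk; rewrite mulnCA.
  by rewrite mulnA leq_mul2r mk orbT.
have small m : (m <= 1)%N -> (m * 31 ^ D <= 32 ^ D)%N.
  move=> m1; apply: leq_trans (leq_mul m1 (leqnn _)) _.
  by rewrite mul1n; case: D {step} => // D; rewrite leq_exp2r.
case: Y XB => [|y Y] /=; first by rewrite inE => /eqP-> _; apply: small.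
case: ifP => Y0; last first.
  by rewrite inE => /eqP-> _; apply: small; move: Y0 => /=; case: (size Y).
set s := shifts _ _; set win := @answer_win a y Y.
have N1 : (1 < #|'I_(size Y).+1|)%N by rewrite card_ord.
have [h1 h2] := split_size s win N1; rewrite card_ord in h1 h2.
rewrite !inE => /orP[] /eqP ->; rewrite size_map; exact: step.
Qed.

Lemma arrangementE st i : perm_eq (flatten st) (enum 'I_n) ->
  arrangement st i = nth i (flatten st) i.
Proof.
move=> pst; rewrite /arrangement; case: pickP => [p /forallP/(_ i)/eqP //|no].
have sz : size (flatten st) = n by rewrite (perm_size pst) size_enum_ord.
have inj : injective (fun i : 'I_n => nth i (flatten st) i).
  move=> j k; rewrite (set_nth_default k) ?sz // => /eqP.
  rewrite nth_uniq ?sz //; last by rewrite (perm_uniq pst) enum_uniq.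
  by move=> /eqP/val_inj.
by have := no (perm inj); case/forallP => j; rewrite permE.
Qed.

End Algorithm.

(** Allows the outcomes at unqueried pairs to be changed freely. The losing term at [y] concerns the
    pair [y - s k], [(y - s k) + s k], so it is covered by the second hypothesis. *)
Lemma eq_split (V : finZmodType) (d : nat) (s : 'I_d -> V) (win win' : rel V) :
  (forall i k, win i (s k) = win' i (s k)) ->
  (forall i k, win i (i + s k) = win' i (i + s k)) ->
  ranking s win = ranking s win' /\ cut s win = cut s win'.
Proof.
move=> h1 h2.
have ep : pivot_wins s win = pivot_wins s win'.
  by apply/funext => y; apply: eq_bigr => k _; rewrite h1.
have es : shift_wins s win = shift_wins s win'.
  apply/funext => y; apply: eq_bigr => k _; rewrite h2.
  by have := h2 (y - s k) k; rewrite subrK => ->.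
have er : ranking s win = ranking s win' by rewrite /ranking /wins_le ep es.
by rewrite /cut er ep.
Qed.

Lemma comparator_win (R : realType) (n : nat) (x : 'I_n -> R) b i j :
  comparator x b i j == i -> x j <= x i + 1.
Proof.
rewrite /comparator; case: ltP => [_|].
  by case: ltP => [h _|h /eqP->]; lra.
by rewrite ler_norml => h _; lra.
Qed.

Lemma comparator_lose (R : realType) (n : nat) (x : 'I_n -> R) b i j :
  comparator x b i j != i -> x i <= x j + 1.
Proof.
rewrite /comparator; case: ltP => [_|].
  by case: ltP => [_|h _]; [rewrite eqxx | lra].
by rewrite ler_norml => h _; lra.
Qed.

Fixpoint ordered (T : Type) (r : rel T) (st : seq (seq T)) : bool :=
  if st is X :: st' then allrel r X (flatten st') && ordered r st' else true.

Lemma ordered_singletons (T : Type) (r : rel T) (st : seq (seq T)) :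
  all (fun X => size X <= 1)%N st -> ordered r st -> pairwise r (flatten st).
Proof.
elim: st => //= X st IH /andP[X1 /IH{}IH] /andP[rX /IH{}IH].
case: X X1 rX => [|y []] //= _.
by rewrite allrel1l IH andbT.
Qed.

(** * Correctness, failure probability and cost against an adversary *)

Section Analysis.
Variables (R : realType) (n d : nat) (x : 'I_n -> R) (adv : adversary n).
Hypothesis d_gt0 : (0 < d)%N.
Local Notation coin := {ffun 'I_d -> 'I_(n`!)}.
Local Notation r := (fun u v => x u <= x v + 4).
Local Notation eta := (expR (- (d%:R * (1 / 64) ^+ 2 / 8)) : R).

Definition good_block (c : coin) (X : seq 'I_n) : bool :=
  if X is y :: X' then `[< well_spread (shifts (size X') c) (x \o @item n y X') >]
  else true.

Lemma split_block_correct (h : seq (answers n)) (Q : {set 'I_n * 'I_n}) c y X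
    (s := shifts (size X) c) (win := @answer_win n (reply x adv h Q) y X) :
  (0 < size X)%N -> block_queries c (y :: X) \subset Q -> good_block c (y :: X) ->
  allrel r (map (@item n y X) (take (cut s win) (ranking s win)))
           (map (@item n y X) (drop (cut s win) (ranking s win))).
Proof.
move=> X0 sQ /asboolP spread; pose it := @item n y X.
(* Unqueried pairs count as lost in [win], so they are answered truthfully here. *)
pose win' : rel 'I_(size X).+1 := fun i j =>
  if (it i, it j) \in Q then win i j else x (it j) <= x (it i).
have q1 i k : (it i, it (s k)) \in Q.
  apply: (fintype.subsetP sQ); rewrite inE; apply/orP; left.
  by apply/imsetP; exists (i, k).
have q2 i k : (it i, it (i + s k)) \in Q.
  apply: (fintype.subsetP sQ); rewrite inE; apply/orP; right.
  by apply/imsetP; exists (i, k).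
have [-> ->] : ranking s win = ranking s win' /\ cut s win = cut s win'.
  by apply: eq_split => i k; rewrite /win' ?q1 ?q2.
apply/allrelP => u v /mapP[i iT ->] /mapP[j jD ->].
apply: (@split_correct R _ d s win' (x \o it) _ _ d_gt0 spread i j) => //.
- move=> {iT jD} {}i {}j; rewrite /win'; case: ifP => [qQ|_] /=; last by lra.
  rewrite /win /answer_win ffunE qQ /= => /eqP[] /eqP; exact: comparator_win.
- move=> {iT jD} {}i {}j; rewrite /win'; case: ifP => [qQ|_] /=; last by rewrite -ltNge; lra.
  rewrite /win /answer_win ffunE qQ /= => h'; apply: (@comparator_lose _ _ _ (adv h Q (it i, it j))).
  by apply: contra h' => /eqP ->.
- by rewrite card_ord.
Qed.

(** Refinement permutes each block, so relations between blocks survive; only the two halves of a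
    block need a new argument. *)
Lemma ordered_refine (h : seq (answers n)) (Q : {set 'I_n * 'I_n}) c st :
  queries c st \subset Q -> all (good_block c) st -> ordered r st ->
  ordered r (refine c (reply x adv h Q) st).
Proof.
elim: st => //= X st IH; rewrite /queries big_cons finset.subUset => /andP[qX /IH{}IH].
case/andP=> gX /IH{}IH /andP[rX /IH{}IH]; rewrite /refine /=.
set a := reply x adv h Q in IH *.
set rest := flatten _; rewrite -/rest in IH.
have {}rX : allrel r X (flatten rest).
  by rewrite (eq_allrel_memr _ _ (perm_mem (perm_refine c a st))).
case: X qX gX rX => [|y X] qX gX rX; first exact: IH.
rewrite [refine_block _ _ _]/=; case: ifP => X0; last exact/andP.
have := split_block_correct h X0 qX gX; rewrite -/a => sc.
move: rX; rewrite -(eq_allrel_meml _ _ (perm_mem (perm_refine_block c a (y :: X)))).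
rewrite [refine_block _ _ _]/= X0 [flatten [:: _; _]]/= cats0 allrel_catl => /andP[r1 r2].
by rewrite /= allrel_catr sc r1 r2.
Qed.

Lemma card_bad_block (X : seq 'I_n) : (size X <= n)%N ->
  #|[pred c | ~~ good_block c X]|%:R <= 8 * (size X)%:R ^+ 2 * (#|{: coin}|%:R * eta).
Proof.
case: X => [|y X] Xn.
  by rewrite eq_card0 //= !mulr_ge0 ?expR_ge0 // sqr_ge0.
have := @card_not_well_spread R (n`!) (size X) d (fact_gt0 n).
by move=> /(_ (dvdn_fact _) (x \o @item n y X)); apply; rewrite /= Xn.
Qed.

Lemma card_bad_level (st : seq (seq 'I_n)) : (size (flatten st) <= n)%N ->
  #|[pred c : coin | ~~ all (good_block c) st]|%:R <=
  8 * (size (flatten st))%:R ^+ 2 * (#|{: coin}|%:R * eta).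
Proof.
elim: st => [|X st IH] /=.
  by rewrite eq_card0 // !mulr_ge0 ?expR_ge0 // sqr_ge0.
rewrite size_cat => hn; have {}IH := IH ltac:(lia).
have hX := @card_bad_block X ltac:(lia).
apply: (@le_trans _ _ (#|[pred c | ~~ good_block c X]|%:R +
   #|[pred c : coin | ~~ all (good_block c) st]|%:R)).
  rewrite -natrD ler_nat -cardUI; apply: leq_trans (leq_addr _ _).
  by apply: subset_leq_card; apply/fintype.subsetP => c; rewrite !inE negb_and.
apply: le_trans (lerD hX IH) _; rewrite -mulrDl -mulrDr.
apply: ler_wpM2r; first by rewrite mulr_ge0 ?expR_ge0.
(* As a^2 + b^2 <= (a + b)^2, the bound for a level does not depend on how the items are divided
   into blocks. *)
rewrite ler_pM2l // natrD sqrrD lerD2r lerDl mulrn_wge0 ?mulr_ge0 //.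
Qed.

Definition sorts h D (st : seq (seq 'I_n)) (w : level_coins n d D) : bool :=
  approx_sorting 4 x (run_from x adv h (sorter w st)).2.

Lemma arrangement_sorted (st : seq (seq 'I_n)) :
  perm_eq (flatten st) (enum 'I_n) -> (forall X, X \in st -> size X <= 1)%N ->
  ordered r st -> approx_sorting 4 x (arrangement st).
Proof.
move=> pst szs ost; apply/forallP => i; apply/forallP => j; apply/implyP => ij.
rewrite /ge_approx !arrangementE //.
have sz : size (flatten st) = n by rewrite (perm_size pst) size_enum_ord.
have /(pairwiseP i) pw : pairwise r (flatten st).
  by apply: ordered_singletons ost; apply/allP.
have := pw i j; rewrite !inE sz => /(_ (ltn_ord _) (ltn_ord _) ij).
by rewrite (@set_nth_default _ (flatten st) i j j) ?sz //; lra.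
Qed.

(** The statement ranges over all transcripts and partitions: once the first coin is fixed, the
    adversary's reply is determined and the induction hypothesis applies to whatever state results.
    This is how adaptivity is handled. *)
Lemma card_not_sorts D h (st : seq (seq 'I_n)) :
  perm_eq (flatten st) (enum 'I_n) ->
  (forall X, X \in st -> size X * 31 ^ D <= 32 ^ D)%N -> ordered r st ->
  #|[pred w : level_coins n d D | ~~ sorts h st w]|%:R <=
  D%:R * (8 * n%:R ^+ 2 * eta) * #|{: level_coins n d D}|%:R.
Proof.
elim: D h st => [|D IH] h st pst szs ost.
  rewrite eq_card0 ?mul0r // => w; rewrite !inE; apply/negbF.
  by apply: arrangement_sorted => // X /szs; rewrite !expn0 muln1.
set b := 8 * _ * _; set K := #|{: level_coins n d D}|%:R : R.
have cardS : #|{: level_coins n d D.+1}|%:R = #|{: coin}|%:R * K :> R.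
  by rewrite /K -natrM -card_prod.
have b0 : 0 <= b by rewrite !mulr_ge0 ?expR_ge0 // sqr_ge0.
have lvl : #|[pred c : coin | ~~ all (good_block c) st]|%:R <= b * #|{: coin}|%:R :> R.
  have sz : size (flatten st) = n by rewrite (perm_size pst) size_enum_ord.
  have := @card_bad_level st; rewrite sz leqnn => /(_ isT) /le_trans; apply.
  by rewrite /b le_eqVlt; apply/orP; left; apply/eqP; ring.
rewrite card_pair natr_sum.
(* A bad first coin is charged all its continuations, a good one only the inductive bound. *)
apply: (@le_trans _ _ (\sum_(c : coin) (D%:R * b * K + (~~ all (good_block c) st)%:R * K))).
  apply: ler_sum => c _; set a := reply x adv h (queries c st).
  have [good|bad] := boolP (all (good_block c) st); last first.
    rewrite mul1r ler_wpDl ?mulr_ge0 // ler_nat; exact: max_card.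
  rewrite mul0r addr0; apply: le_trans (IH (rcons h a) (refine c a st) _ _ _).
  - by [].
  - exact: perm_trans (perm_refine _ _ _) pst.
  - exact: size_refine.
  - exact: ordered_refine.
rewrite big_split /= sumr_const -mulr_suml -natr_sum cardS.
have -> : (\sum_(c : coin) ~~ all (good_block c) st =
           #|[pred c : coin | ~~ all (good_block c) st]|)%N.
  by rewrite -sum1_card [RHS]big_mkcond.
have : #|[pred c : coin | ~~ all (good_block c) st]|%:R * K <= b * #|{: coin}|%:R * K.
  by apply: ler_wpM2r.
rewrite -natr1 -[X in X + _ <= _]mulr_natl; lra.
Qed.

Lemma size_run D h st (w : level_coins n d D) :
  size (run_from x adv h (sorter w st)).1 = (size h + D)%N.
Proof.
elim: D h st w => [|D IH] h st w /=; first by rewrite addn0.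
by rewrite IH size_rcons addSnnS.
Qed.

Lemma comparisons_run D h st (w : level_coins n d D) :
  perm_eq (flatten st) (enum 'I_n) ->
  (\sum_(a <- (run_from x adv h (sorter w st)).1) #|[set p | isSome (a p)]|
   <= \sum_(a <- h) #|[set p | isSome (a p)]| + D * (2 * d * n))%N.
Proof.
elim: D h st w => [|D IH] h st w pst /=; first by rewrite addn0.
apply: leq_trans (IH _ _ _ _) _; first exact: perm_trans (perm_refine _ _ _) pst.
rewrite big_rcons /= (mulSn D) -addnA leq_add2l leq_add2r.
have sz : size (flatten st) = n by rewrite (perm_size pst) size_enum_ord.
have := card_queries w.1 st; rewrite sz; apply: leq_trans; apply: subset_leq_card.
by apply/fintype.subsetP => p; rewrite inE ffunE; case: ifP.
Qed.

End Analysis.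

(** * Choice of parameters and final bounds *)

Lemma leq_mul_expSn (n L k : nat) : (0 < k)%N -> (n <= 2 ^ L)%N ->
  (n * k ^ (k * L) <= k.+1 ^ (k * L))%N.
Proof.
(* The first two binomial terms give (1 + 1/k)^k >= 2, so k levels halve the blocks. *)
move=> k0 nL; have two : (2 * k ^ k <= k.+1 ^ k)%N.
  case: k k0 => // k _; rewrite -[in leqRHS](addn1 k.+1) expnDn !big_ord_recl.
  rewrite /bump !bin0 !bin1 subn0 !exp1n !muln1 !mul1n subn1 addnA -expnS.
  by rewrite mul2n -addnn leq_addr.
apply: leq_trans (leq_mul nL (leqnn _)) _; rewrite !expnM -expnMn.
by case: L nL => [|L] _; [rewrite !expn0 | rewrite leq_exp2r].
Qed.

Section RandomizedSorter.
Variables (R : realType) (n d D : nat).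
Local Notation W := (level_coins n d D).

Lemma card_level_coins_gt0 : (0 < #|{: W}|)%N.
Proof.
elim: D => [|k IH]; first by rewrite card_unit.
by rewrite /= card_prod muln_gt0 IH card_ffun !card_ord expn_gt0 fact_gt0.
Qed.

Lemma uniform_sum1 : \sum_(w : W) #|{: W}|%:R^-1 = 1 :> R.
Proof.
rewrite sumr_const -[LHS]mulr_natr mulVf // pnatr_eq0 -lt0n; exact: card_level_coins_gt0.
Qed.

Definition random_sorter : rand_alg R n :=
  @RandAlg R n W (fun=> #|{: W}|%:R^-1) (fun=> ltac:(by rewrite invr_ge0))
    uniform_sum1 (fun w => sorter w [:: enum 'I_n]).

Lemma Pr_random_sorter (x : 'I_n -> R) (adv : adversary n) : (0 < d)%N ->
  (n * 31 ^ D <= 32 ^ D)%N ->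
  1 - D%:R * (8 * n%:R ^+ 2 * expR (- (d%:R * (1 / 64) ^+ 2 / 8))) <=
  Pr (fun w : coins random_sorter => approx_sorting 4 x (output x adv (strat w))).
Proof.
move=> d0 nD; pose E : pred W := fun w => approx_sorting 4 x (output x adv (sorter w [:: enum 'I_n])).
have -> : Pr (fun w : coins random_sorter => approx_sorting 4 x (output x adv (strat w))) =
  \sum_(w in E) #|{: W}|%:R^-1 by [].
have pst : perm_eq (flatten [:: enum 'I_n]) (enum 'I_n) by rewrite /= cats0.
have szs X : X \in [:: enum 'I_n] -> (size X * 31 ^ D <= 32 ^ D)%N.
  by rewrite inE => /eqP->; rewrite size_enum_ord.
have ost : ordered (fun u v => x u <= x v + 4) [:: enum 'I_n] by rewrite /= allrel0r.
have h := card_not_sorts adv d0 [::] pst szs ost.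
rewrite sumr_const -[leRHS]mulr_natr.
have W0 : 0 < #|{: W}|%:R :> R by rewrite ltr0n card_level_coins_gt0.
have hC : #|E|%:R + #|[pred w | ~~ E w]|%:R = #|{: W}|%:R :> R.
  by rewrite -natrD (cardC E).
move: h; rewrite -ler_pdivrMr //; set bad := #|_|%:R; set b := D%:R * _.
have -> : bad = #|{: W}|%:R - #|E|%:R by rewrite -hC addrC addKr.
by rewrite mulrBl divff ?gt_eqF // mulrC; lra.
Qed.

Lemma rounds_random_sorter (x : 'I_n -> R) (adv : adversary n)
    (w : coins random_sorter) : num_rounds x adv (strat w) = D.
Proof. exact: size_run. Qed.

Lemma comparisons_random_sorter (x : 'I_n -> R) (adv : adversary n)
    (w : coins random_sorter) :
  (num_comparisons x adv (strat w) <= D * (2 * d * n))%N.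
Proof.
have := @comparisons_run R n d x adv D [::] [:: enum 'I_n] w.
by rewrite /= cats0 perm_refl big_nil; apply.
Qed.

End RandomizedSorter.

(** The rounded logarithm exceeds log2 n by at most 1, and 1 <= log2 n. *)
Lemma up_log2_le_ln (R : realType) (n : nat) : (1 < n)%N ->
  (up_log 2 n)%:R <= 2 / ln 2 * ln n%:R :> R.
Proof.
move=> n1; have l2 : 0 < ln 2 :> R by rewrite ln_gt0 // ltr1n.
have /andP[lb _] := @up_log_bounds 2 n isT n1.
have L0 : (0 < up_log 2 n)%N by rewrite up_log_gt0.
have ln_mono (a b : nat) : (0 < a)%N -> (a <= b)%N -> ln a%:R <= ln b%:R :> R.
  by move=> a0 ab; rewrite ler_ln ?posrE ?ltr0n ?ler_nat //; apply: leq_trans ab.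
have h1 : (up_log 2 n).-1%:R * ln 2 <= ln n%:R :> R.
  have := ln_mono (2 ^ (up_log 2 n).-1)%N n _ (ltnW lb).
  by rewrite expn_gt0 => /(_ isT); rewrite natrX lnXn // mulr_natl.
have h2 := ln_mono 2%N n isT n1.
rewrite -mulrA mulrC -mulrA mulrC ler_pdivlMr //; move: h1.
by rewrite -[in X in _ -> X](prednK L0) -natr1; lra.
Qed.

Lemma failure_small (R : realType) (n L K : nat) : (1 < n)%N -> (n <= 2 ^ L)%N ->
  13 * (8 * 64 ^+ 2) <= K%:R :> R ->
  (31 * L)%:R * (8 * n%:R ^+ 2 * expR (- ((K * L).+1%:R * (1 / 64) ^+ 2 / 8)))
    < 1 / n%:R ^+ 2 :> R.
Proof.
move=> n1 nL hK.
have nr : 0 < n%:R :> R by rewrite ltr0n; lia.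
set e := (K * L).+1%:R * _ / 8.
(* The bound on [K] makes the exponent at least 13 L, and exp(1) >= 2. *)
have he : (2 ^ (13 * L))%:R <= expR e.
  rewrite natrX; have e2 : 2 <= expR 1 :> R by have := expR_ge1Dx (1 : R); lra.
  apply: (@le_trans _ _ (expR 1 ^+ (13 * L))); first by apply: lerXn2r; rewrite ?nnegrE ?expR_ge0.
  rewrite -expRM_natl mulr1 ler_expR /e -natr1 !natrM.
  have : 0 <= (K%:R - 13 * (8 * 64 ^+ 2)) * L%:R :> R by rewrite mulr_ge0 ?subr_ge0.
  lra.
(* Here 248 = 31 * 8, and n^4 joins n^2 from the union bound to n^2 from the target. The three
   factors are absorbed by 2^(8 L), 2^L and 2^(4 L). *)
have hn : (248 * L * n ^ 4 < 2 ^ (13 * L))%N.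
  have -> : (13 * L = 8 * L + L + 4 * L)%N by lia.
  rewrite (expnD 2 (8 * L + L) (4 * L)) (expnD 2 (8 * L) L); apply: (@leq_ltn_trans (248 * L * 2 ^ (4 * L))).
    by rewrite leq_mul2l [(4 * L)%N]mulnC expnM leq_exp2r // nL orbT.
  rewrite ltn_pmul2r ?expn_gt0 //; apply: ltn_mul; last exact: ltn_expl.
  case: L nL {he e} => [|L] nL; first by move: n1 nL; rewrite expn0; lia.
  rewrite expnM; apply: (@leq_trans ((2 ^ 8) ^ 1)); first by [].
  by rewrite leq_exp2l.
rewrite expRN ltr_pdivlMr ?exprn_gt0 //.
have -> : (31 * L)%:R * (8 * n%:R ^+ 2 * (expR e)^-1) * n%:R ^+ 2 =
   (248 * L * n ^ 4)%:R / expR e :> R.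
  rewrite (natrM _ 31 L) (natrM _ (248 * L) (n ^ 4)) (natrM _ 248 L) natrX.
  by field; rewrite gt_eqF ?expR_gt0.
rewrite ltr_pdivrMr ?expR_gt0 // mul1r; apply: lt_le_trans he.
by rewrite ltr_nat.
Qed.

Theorem theorem1p5 (R : realType) :
  exists (A : forall n : nat, rand_alg R n) (C : R),
    (forall n : nat, (1 < n)%N ->
       forall (x : 'I_n -> R) (adv : adversary n) (w : coins (A n)),
         (num_comparisons x adv (strat w))%:R <= C * (n%:R * ln n%:R ^+ 2) /\
         (num_rounds x adv (strat w))%:R <= C * ln n%:R) /\
    (forall n : nat, (0 < n)%N ->
       forall (x : 'I_n -> R) (adv : adversary n),
         1 - 1 / n%:R ^+ 2 <
         Pr (fun w : coins (A n) => approx_sorting 4 x (output x adv (strat w)))).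
Proof.
have [K hK] : exists K : nat, 13 * (8 * 64 ^+ 2) <= K%:R :> R.
  by exists (Num.bound (13 * (8 * 64 ^+ 2) : R)); apply/ltW/archi_boundP; lra.
pose L n := up_log 2 n.
(* The successor keeps the number of shifts positive when [L n = 0]. *)
exists (fun n => random_sorter R n (K * L n).+1 (31 * L n)).
have [c c0 Lc] : exists2 c : R, 0 <= c &
    forall n, (1 < n)%N -> (L n)%:R <= c * ln n%:R.
  exists (2 / ln 2); last exact: up_log2_le_ln.
  by rewrite divr_ge0 // ln_ge0 // ler1n.
(* The first term bounds the comparisons, D * 2 d n <= 62 (K + 1) L^2 n; the second bounds the 31 L
   rounds. *)
exists (62 * K.+1%:R * c ^+ 2 + 31 * c); split => n n0 x adv; last first.
  have nL : (n <= 2 ^ L n)%N by apply: up_logP.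
  apply: lt_le_trans (Pr_random_sorter x adv (ltn0Sn _) (leq_mul_expSn (k := 31) isT nL)).
  rewrite ltrD2l ltrN2; case: (ltnP 1 n) => n1; first exact: failure_small.
  (* For a single item there are no levels, so the failure bound is 0 < 1. *)
  have -> : n = 1%N by lia.
  by rewrite /L up_log1 muln0 mul0r expr1n divr1.
move=> w; rewrite rounds_random_sorter.
have hL := Lc n n0.
have ln0 : 0 <= ln n%:R :> R by rewrite ln_ge0 // ler1n ltnW.
split; last first.
  rewrite natrM mulrDl -mulrA; have : 0 <= 62 * K.+1%:R * c ^+ 2 * ln n%:R.
    by rewrite mulr_ge0 // mulr_ge0 ?sqr_ge0 // mulr_ge0.
  by move: hL; lra.
apply: (@le_trans _ _ ((62 * K.+1) * (L n) ^ 2 * n)%N%:R).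
  rewrite ler_nat; apply: leq_trans (comparisons_random_sorter _ _ _) _.
  have L1 : (1 <= L n)%N by rewrite up_log_gt0.
  have h : ((K * L n).+1 <= K.+1 * L n)%N by rewrite mulSn; lia.
  apply: (@leq_trans (31 * L n * (2 * (K.+1 * L n) * n))).
    by rewrite leq_mul2l leq_mul2r leq_mul2l h !orbT.
  by rewrite expnS expn1; apply/eq_leq; lia.
rewrite (natrM _ _ n) (natrM _ _ (L n ^ 2)) (natrM _ 62) natrX mulrDl.
have h2 : (L n)%:R ^+ 2 <= (c * ln n%:R) ^+ 2.
  by apply: lerXn2r => //; rewrite nnegrE ?mulr_ge0.
have : 62 * K.+1%:R * n%:R * (L n)%:R ^+ 2 <=
       62 * K.+1%:R * n%:R * (c * ln n%:R) ^+ 2.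
  by apply: ler_wpM2l => //; rewrite !mulr_ge0.
have : 0 <= 31 * c * (n%:R * ln n%:R ^+ 2) by rewrite !mulr_ge0 // ?sqr_ge0.
by rewrite exprMn; lra.
Qed.
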